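(* Every compact Hausdorff space has a unique maximal $\eta$-subspace.
   Context: For a compact Hausdorff space $X$, $C(X)$ denotes the algebra of complex-valued continuous functions on $X$. A map $T$ on $C(X)$ is additive if $T(f+g)=T(f)+T(g)$ for all $f,g$; it is a multiplication if there is $a\in C(X)$ with $T(f)=af$ for all $f\in C(X)$; it is a local multiplication if for each $f\in C(X)$ there is $a_f\in C(X)$ with $T(f)=a_f f$. A compact Hausdorff space $X$ is an $\eta$-space if every additive local multiplication on $C(X)$ is a multiplication (the empty space is allowed and counts as an $\eta$-space). An $\eta$-subspace of a compact Hausdorff space $X$ is a compact subspace of $X$ that is an $\eta$-space; maximality is with respect to inclusion. *)

(* Defs.v *)
From HB Require Import structures.
From mathcomp Require Import all_boot all_order all_algebra.
From mathcomp Require Import all_classical all_reals all_analysis.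
From mathcomp Require Import complex.

Set Implicit Arguments.
Unset Strict Implicit.
Unset Printing Implicit Defensive.

Import Order.TTheory GRing.Theory Num.Theory numFieldNormedType.Exports.
Local Open Scope classical_set_scope.
Local Open Scope ring_scope.
Local Open Scope complex_scope.

(* The algebra C(X).  The regular algebra [R[i]^o] is the complex field with
   the topology of its modulus; [R[i]] itself carries no topology. *)
Definition Cfun (R : realType) (X : topologicalType) : Type :=
  continuousType X R[i]^o.

Section Cfun_ring.
Context (R : realType) (X : topologicalType).

HB.instance Definition _ := Choice.copy (Cfun R X) (continuousType X R[i]^o).

Definition continuous_pred : {pred X -> R[i]^o} := mem [set f | continuous f].

Definition Cfun_Sub (f : X -> R[i]^o) (fP : f \in continuous_pred) : Cfun R X :=
  (mkcts (set_mem fP) : continuousType X R[i]^o).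

Lemma Cfun_rect (K : Cfun R X -> Type) :
  (forall f (fP : f \in continuous_pred), K (Cfun_Sub fP)) -> forall u, K u.
Proof.
move=> KS u.
have uP : (u : X -> R[i]^o) \in continuous_pred by apply/mem_set; exact: cts_fun.
suff <- : Cfun_Sub uP = u by exact: KS.
exact/continuousEP.
Qed.

Lemma Cfun_valP f (fP : f \in continuous_pred) : Cfun_Sub fP = f :> (X -> R[i]^o).
Proof. by []. Qed.

HB.instance Definition _ :=
  isSub.Build (X -> R[i]^o) continuous_pred (Cfun R X) Cfun_rect Cfun_valP.

Lemma continuous_subring_closed : subring_closed continuous_pred.
Proof.
split=> [|f g /set_mem cf /set_mem cg|f g /set_mem cf /set_mem cg];
  apply/mem_set => x.
- exact: cvg_cst.
- by apply: cvgB; [exact: cf|exact: cg].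
- by apply: (@cvgM R[i]); [exact: cf|exact: cg].
Qed.

HB.instance Definition _ :=
  GRing.isSubringClosed.Build (X -> R[i]^o) continuous_pred
    continuous_subring_closed.

HB.instance Definition _ :=
  GRing.SubChoice_isSubComPzRing.Build (X -> R[i]^o) continuous_pred (Cfun R X)
    (GRing.subringClosedP _).

Lemma CfunD (f g : Cfun R X) x : (f + g) x = f x + g x.
Proof. by []. Qed.

Lemma CfunM (f g : Cfun R X) x : (f * g) x = f x * g x.
Proof. by []. Qed.

End Cfun_ring.

Definition multiplication (R : realType) (X : topologicalType)
    (T : Cfun R X -> Cfun R X) : Prop :=
  exists a : Cfun R X, forall f, T f = a * f.

Definition local_multiplication (R : realType) (X : topologicalType)
    (T : Cfun R X -> Cfun R X) : Prop :=
  forall f, exists a : Cfun R X, T f = a * f.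

Definition eta_space (R : realType) (X : topologicalType) : Prop :=
  [/\ compact [set: X], hausdorff_space X &
      forall T : Cfun R X -> Cfun R X,
        {morph T : f g / f + g} -> local_multiplication T -> multiplication T].

(* [set_type A] carries the topology induced by [X]. *)
Definition eta_subspace (R : realType) (X : topologicalType) (A : set X) : Prop :=
  compact A /\ eta_space R (set_type A).

Definition maximal_eta_subspace (R : realType) (X : topologicalType)
    (A : set X) : Prop :=
  eta_subspace R A /\ forall B : set X, eta_subspace R B -> A `<=` B -> B = A.

(* Main.v *)
Require Import Defs.
From mathcomp Require Import all_boot all_order all_algebra.
From mathcomp Require Import all_classical all_reals all_analysis.
From mathcomp Require Import complex.

(** The closure [M] of the union of all eta-subspaces of [X] is itself an
    eta-subspace, hence the greatest one; a greatest element is the unique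
    maximal element.

    To see that [M] is an eta-space, let [T] be an additive local
    multiplication on C(M).  A local multiplication sends a function vanishing
    at a point to a function vanishing there, so by additivity the value of
    [T f] at a point depends only on the value of [f] there.  Let [A] be an
    eta-subspace.  By Tietze's theorem ([Cfun_extension]) every function in
    C(A) extends to [M], so [T] descends to an additive local multiplication on
    C(A), which is a multiplication since [A] is an eta-space.  Its multiplier
    is the image of 1, so [T f] and [T 1 * f] agree on [A]
    ([local_multiplication_on_range]).  They then agree on the union of the
    eta-subspaces, which is dense in [M], and so on [M]
    ([eta_subspace_closure_bigcup]). *)

Set Implicit Arguments.
Unset Strict Implicit.
Unset Printing Implicit Defensive.
Import Order.TTheory GRing.Theory Num.Theory numFieldNormedType.Exports.
Local Open Scope classical_set_scope.
Local Open Scope ring_scope.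

(** Tietze's theorem is about real functions; this reduces complex functions to
    their real and imaginary parts. *)
Lemma cvg_complexP (R : realType) (T : Type) (F : set_system T) {FF : Filter F}
    (f : T -> R[i]^o) (z : R[i]^o) :
  f @ F --> z <->
  (complex.Re (f t) @[t --> F] --> (complex.Re z : R^o)) /\
  (complex.Im (f t) @[t --> F] --> (complex.Im z : R^o)).
Proof.
have leRe (w : R[i]) : `|complex.Re w|%:C%C <= `|w|.
  by rewrite normc_def lecR -sqrtr_sqr ler_wsqrtr // lerDl sqr_ge0.
have leIm (w : R[i]) : `|complex.Im w|%:C%C <= `|w|.
  by rewrite normc_def lecR -sqrtr_sqr ler_wsqrtr // lerDr sqr_ge0.
split=> [/cvgrPdist_lt cf|[/cvgrPdist_lt cRe /cvgrPdist_lt cIm]].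
  split; apply/cvgrPdist_lt => e e0.
  - have e0' : 0 < e%:C%C :> R[i] by rewrite ltcR.
    apply: filterS (cf _ e0') => t /(le_lt_trans (leRe _)).
    by rewrite ltcR; case: (z) (f t) => [a b] [c d].
  - have e0' : 0 < e%:C%C :> R[i] by rewrite ltcR.
    apply: filterS (cf _ e0') => t /(le_lt_trans (leIm _)).
    by rewrite ltcR; case: (z) (f t) => [a b] [c d].
(* A positive element of [R[i]] is real, so the radius is some [e%:C]. *)
apply/cvgrPdist_lt => -[e e']; rewrite ltcE /= => /andP[/eqP -> e0].
have e20 : 0 < e / 2 by rewrite divr_gt0.
near=> t.
have : `|complex.Re z - complex.Re (f t)| < e / 2 by near: t; exact: cRe.
have : `|complex.Im z - complex.Im (f t)| < e / 2 by near: t; exact: cIm.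
case: (z) (f t) => [a b] [c d] /= bd ac.
have -> : (a +i* b)%C - (c +i* d)%C = (a - c)%:C%C + 'i%C * (b - d)%:C%C.
  by rewrite [LHS]complexE.
apply: le_lt_trans (ler_normD _ _) _.
have Ni : `|'i%C| = 1 :> R[i].
  by rewrite normc_def /= expr0n add0r expr1n sqrtr1.
have Nr (r : R) : `|r%:C%C| = `|r|%:C%C :> R[i].
  by rewrite normc_def /= expr0n addr0 sqrtr_sqr.
by rewrite normrM Ni mul1r !Nr -rmorphD ltcR [ltRHS]splitr ltrD.
Unshelve. all: by end_near.
Qed.

Lemma compact_set_type (X : topologicalType) (A : set X) :
  compact A -> compact [set: set_type A].
Proof.
move=> cA F PF _.
have [|p [Ap clp]] := cA (set_val @ F) (fmap_proper_filter _ PF) _.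
  rewrite /fmap /nbhs /=.
  by apply: (@filterS _ F _ setT) => [x _|]; [exact: set_valP|exact: filterT].
exists (SigSub (mem_set Ap)); split => // B C FB [W [[V oV <-] Vp VC]].
have FB' : (set_val @ F) (set_val @` B).
  by apply: (@filterS _ F _ B) FB => b Bb; exists b.
have [_ [[b Bb <-] Vb]] := clp _ V FB' (open_nbhs_nbhs (conj oV Vp)).
by exists b; split => //; exact: VC.
Qed.

Lemma continuous_set_val (X : topologicalType) (A : set X) :
  continuous (set_val : set_type A -> X).
Proof. exact: initial_continuous. Qed.

Lemma hausdorff_set_type (X : topologicalType) (A : set X) :
  hausdorff_space X -> hausdorff_space (set_type A).
Proof.
move=> hX x y cxy; apply: val_inj; apply: hX => U V Ux Vy.
have [z [Uz Vz]] := cxy _ _ (continuous_set_val Ux) (continuous_set_val Vy).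
by exists (set_val z).
Qed.

(** Tietze's theorem needs a bound on [u], which compactness of [A] provides. *)
Lemma real_extension (R : realType) (X : topologicalType) (A : set X) :
  compact [set: X] -> hausdorff_space X -> compact A ->
  forall u : set_type A -> R^o, continuous u ->
  exists2 g : X -> R^o, continuous g & forall x, g (set_val x) = u x.
Proof.
move=> cX hX cA u cu.
have [M [_ Mu]] : bounded_set (range u).
  apply: compact_bounded; apply: continuous_compact.
    exact: continuous_subspaceT.
  exact: compact_set_type.
(* [M] is only a threshold above which every number bounds [u]; Tietze's
   theorem asks for a positive bound. *)
have M1 : M < `|M| + 1 by rewrite ltr_pwDr // ler_norm.
have [|||g [gu cg _]] := @continuous_bounded_extension X R
    (compact_normal hX cX) A (compact_closed hX cA)
    (valL_ (0 : R) u) (`|M| + 1).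
- by rewrite ltr_wpDl.
- exact/subspace_valL_continuousP'.
- move=> x Ax; rewrite (_ : x = set_val (SigSub (mem_set Ax))) //.
  have := congr1 (@^~ (SigSub (mem_set Ax))) (valLK (0 : R) u).
  by rewrite /sigL /= => ->; apply: (Mu _ M1); eexists.
exists g => // x; rewrite -gu; last exact/mem_set/set_valP.
by rewrite -[in RHS](valLK (0 : R) u).
Qed.

Lemma Cfun_extension (R : realType) (X : topologicalType) (A : set X) :
  compact [set: X] -> hausdorff_space X -> compact A ->
  forall u : Cfun R (set_type A),
  exists g : Cfun R X, forall x, g (set_val x) = u x.
Proof.
move=> cX hX cA u.
have cu : continuous (u : set_type A -> R[i]^o) by exact: cts_fun.
have [|g cg gE] := @real_extension R X A cX hX cA (fun x => complex.Re (u x)).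
  by move=> x; have /cvg_complexP[] := cu x.
have [|h ch hE] := @real_extension R X A cX hX cA (fun x => complex.Im (u x)).
  by move=> x; have /cvg_complexP[] := cu x.
pose k x : R[i]^o := (g x +i* h x)%C.
have ck : k \in @continuous_pred R X.
  by apply/mem_set => x; apply/cvg_complexP; split; [exact: cg|exact: ch].
exists (Cfun_Sub ck) => x; change (k (set_val x) = u x).
by rewrite /k gE hE; case: (u x).
Qed.

(** The subspace enters only as a continuous map [j] along which every function
    extends.  Then C(K) is the quotient of C(Y) by the functions vanishing on
    the range of [j]; [T] preserves that ideal because [T f] is a multiple of
    [f], so it induces an operator on C(K), to which the eta-property of [K]
    applies. *)
Lemma local_multiplication_on_range (R : realType) (K Y : topologicalType)
    (j : K -> Y) (T : Cfun R Y -> Cfun R Y) :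
  continuous j -> eta_space R K ->
  (forall u : Cfun R K, exists g : Cfun R Y, forall x, g (j x) = u x) ->
  {morph T : f g / f + g} -> local_multiplication T ->
  forall f x, T f (j x) = (T 1 * f) (j x).
Proof.
move=> cj [_ _ etaK] ext Tadd Tloc.
have res_cts (f : Cfun R Y) : f \o j \in @continuous_pred R K.
  apply/mem_set => x; apply: continuous_comp; first exact: cj.
  exact: cts_fun.
pose res f := Cfun_Sub (res_cts f) : Cfun R K.
have [E EK] := choice ext.
have CfunP (u v : Cfun R K) : (forall x, u x = v x) -> u = v.
  by move=> uv; exact/continuousEP.
(* [T f - T g = T (f - g)] is a multiple of [f - g], so the restriction of [T f]
   depends only on that of [f]. *)
have TE (f g : Cfun R Y) :
    (forall x, f (j x) = g (j x)) -> res (T f) = res (T g).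
  move=> fg; apply: CfunP => x; change (T f (j x) = T g (j x)).
  have [a ad] := Tloc (f - g).
  have : T f = T (f - g) + T g by rewrite -Tadd subrK.
  move=> ->; rewrite CfunD ad CfunM.
  have -> : (f - g) (j x) = f (j x) - g (j x) by [].
  by rewrite fg subrr mulr0 add0r.
have [||a Ta] := etaK (fun u => res (T (E u))).
- move=> u v.
  have -> : res (T (E u)) + res (T (E v)) = res (T (E u) + T (E v)).
    exact: CfunP.
  rewrite -Tadd.
  by apply: TE => x; rewrite CfunD !EK CfunD.
- move=> u; have [a aE] := Tloc (E u); exists (res a).
  apply: CfunP => x; rewrite aE.
  by change (a (j x) * E u (j x) = a (j x) * u x); rewrite EK.
have resT (f : Cfun R Y) x : T f (j x) = a x * f (j x).
  have := congr1 (fun u : Cfun R K => u x) (Ta (res f)).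
  by rewrite (TE (E (res f)) f) => // y; rewrite EK.
(* Taking [1] for [f] in [resT] identifies [a] with the restriction of [T 1]. *)
by move=> f x; rewrite CfunM !resT -mulrA mul1r.
Qed.

Lemma Cfun_eq_dense (R : realType) (Y : topologicalType) (D : set Y)
    (f g : Cfun R Y) :
  closure D = setT -> (forall x, D x -> f x = g x) -> f = g.
Proof.
move=> dD fg; apply/continuousEP => y.
have cfg : continuous ((f - g : Cfun R Y) : Y -> R[i]^o) by exact: cts_fun.
have clZ : closed [set x | (f - g : Cfun R Y) x = 0].
  apply: (@preimage_closed _ _ _ [set 0 : R[i]^o]) => [x _|]; first exact: cfg.
  by apply: accessible_closed_set1; apply: hausdorff_accessible;
    exact: norm_hausdorff.
have : closure D y by rewrite dD.
move=> /(@closureS _ _ [set x | (f - g : Cfun R Y) x = 0]).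
rewrite -(closure_id _).1 // => /(_ _)/subr0_eq; apply=> x Dx /=.
by change (f x - g x = 0); rewrite fg // subrr.
Qed.

(** The multiplier of [T] on the closure is [T 1], a global function, so the
    multipliers found on the separate members of [S] need no gluing. *)
Lemma eta_subspace_closure_bigcup (R : realType) (X : topologicalType)
    (S : set (set X)) :
  compact [set: X] -> hausdorff_space X ->
  (forall A, S A -> eta_subspace R A) ->
  eta_subspace R (closure (\bigcup_(A in S) A)).
Proof.
move=> cX hX etaS; set U := \bigcup_(A in S) A.
have cU : compact (closure U).
  by apply: subclosed_compact cX _ => //; exact: closed_closure.
split=> //; split; [exact: compact_set_type|exact: hausdorff_set_type|].
move=> T Tadd Tloc; exists (T 1) => f.
apply: (@Cfun_eq_dense _ _ (set_val @^-1` U)).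
  apply/seteqP; split=> // y _ V [W [[G oG <-] Gy GW]].
  have [z [Uz Gz]] := set_valP y _ (open_nbhs_nbhs (conj oG Gy)).
  exists (SigSub (mem_set (@subset_closure _ U z Uz))).
  by split=> //; exact: GW.
move=> y [A SA Ay].
have [cA etaA] := etaS A SA.
have AU : A `<=` closure U.
  by apply: subset_trans (@subset_closure _ U); exact: bigcup_sup.
pose j (x : set_type A) : set_type (closure U) :=
  SigSub (mem_set (AU _ (set_valP x))).
have -> : y = j (SigSub (mem_set Ay)) by exact: val_inj.
apply: local_multiplication_on_range etaA _ Tadd Tloc f _.
  by apply: continuous_comp_initial; exact: continuous_set_val.
move=> u; have [g gE] := Cfun_extension cX hX cA u.
have rg : g \o set_val \in @continuous_pred R (set_type (closure U)).
  apply/mem_set => x; apply: continuous_comp; first exact: continuous_set_val.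
  exact: cts_fun.
by exists (Cfun_Sub rg) => x; rewrite -gE.
Qed.

Theorem theorem5 (R : realType) (X : topologicalType)
    (compactX : compact [set: X]) (hausdorffX : hausdorff_space X) :
  exists! A : set X, maximal_eta_subspace R A.
Proof.
pose M : set X := closure (\bigcup_(A in [set B : set X | eta_subspace R B]) A).
have etaM : eta_subspace R M by exact: eta_subspace_closure_bigcup.
have M_max A : eta_subspace R A -> A `<=` M.
  move=> etaA; apply: subset_trans (@subset_closure _ _).
  exact: (bigcup_sup etaA).
exists M; split.
  by split=> // B etaB MB; apply/seteqP; split=> //; exact: M_max.
by move=> B [etaB maxB]; apply: maxB => //; exact: M_max.
Qed.
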